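(* Let $K\subset\mathbb{R}^n$ be a nonempty closed convex set and let $f:\mathbb{R}^n\to\mathbb{R}$ be a polynomial of degree $d\geq 2$ which is pseudoconvex on an open set containing $K$. If $\mathrm{OP}(K,f)$ is non-regular, then the following statements are equivalent: (a) if $v\in\mathrm{Sol}(K_\infty,f_d)\setminus\{0\}$, then there exists $x\in K$ such that $\langle\nabla f(x),v\rangle>0$; (b) $\mathrm{Sol}(K,f)$ is nonempty and compact.
   Context: $\mathrm{OP}(K,f)$ denotes the problem of minimizing $f(x)$ subject to $x\in K$, and $\mathrm{Sol}(K,f)$ denotes its set of (global) minimizers; $\mathrm{Sol}(S,g)$ has the same meaning for any closed set $S$ and polynomial $g$. The asymptotic cone of a nonempty closed set $S\subset\mathbb{R}^n$ is $S_\infty=\{v\in\mathbb{R}^n:\exists t_k\to+\infty,\ \exists x_k\in S \text{ with } \lim_{k\to\infty} x_k/t_k=v\}$. $f_d$ denotes the homogeneous component of degree $d$ of $f$, where $d=\deg f$. The problem $\mathrm{OP}(K,f)$ is called regular if $\mathrm{Sol}(K_\infty,f_d)$ is bounded (the empty set counts as bounded), and non-regular otherwise. A polynomial $f$ is pseudoconvex on an open set $U\subset\mathbb{R}^n$ if, for any $x,y\in U$ such that $\langle\nabla f(x),y-x\rangle\geq 0$, one has $f(y)\geq f(x)$, where $\nabla f$ is the gradient of $f$. *)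

(* Defs.v *)
From HB Require Import structures.
From mathcomp Require Import all_boot all_order all_algebra.
From mathcomp Require Import all_classical all_reals all_analysis.
(* The notations of mpoly clash with those of mathcomp-analysis. *)
From mathcomp Require mpoly.
Import (canonicals, coercions) mpoly.

Set Implicit Arguments.
Unset Strict Implicit.
Unset Printing Implicit Defensive.

Import Order.TTheory GRing.Theory Num.Theory.
Import numFieldNormedType.Exports.

Local Open Scope classical_set_scope.
Local Open Scope ring_scope.

(* Points of R^n are row vectors 'rV[R]_n. The library norm on them is the sup
   norm, which yields the usual open, closed, bounded and compact sets. *)

Definition inner (R : realType) (n : nat) (u v : 'rV[R]_n) : R :=
  \sum_(i < n) u 0 i * v 0 i.

(* The i-th entry is the directional derivative along the i-th basis vector. *)
Definition gradient (R : realType) (n : nat) (g : 'rV[R]_n -> R)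
    (x : 'rV[R]_n) : 'rV[R]_n :=
  \row_(i < n) 'D_(delta_mx 0 i : 'rV[R]_n) g x.

Definition pseudoconvex_on (R : realType) (n : nat) (U : set 'rV[R]_n)
    (g : 'rV[R]_n -> R) : Prop :=
  forall x y, U x -> U y -> 0 <= inner (gradient g x) (y - x) -> g x <= g y.

Definition Sol (R : realType) (n : nat) (S : set 'rV[R]_n)
    (g : 'rV[R]_n -> R) : set 'rV[R]_n :=
  [set x | S x /\ forall y, S y -> g x <= g y].

Definition asymptotic_cone (R : realType) (n : nat) (S : set 'rV[R]_n) :
    set 'rV[R]_n :=
  [set v | exists (t : nat -> R) (x : nat -> 'rV[R]_n),
     [/\ t @ \oo --> +oo, forall k, S (x k) &
         (fun k => (t k)^-1 *: x k) @ \oo --> v]].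

Definition polyfun (R : realType) (n : nat) (f : mpoly.mpoly n R) :
    'rV[R]_n -> R :=
  fun x => mpoly.meval (fun i => x 0 i) f.

(* mpoly.mmeasure mpoly.mdeg is 1 + the total degree of a nonzero polynomial,
   and 0 for the zero polynomial, whose degree is thus 0 here. *)
Definition mpoly_degree (R : realType) (n : nat) (f : mpoly.mpoly n R) : nat :=
  (mpoly.mmeasure mpoly.mdeg f).-1.

Definition homog_component (R : realType) (n : nat) (d : nat)
    (f : mpoly.mpoly n R) : mpoly.mpoly n R :=
  mpoly.pihomog mpoly.mdeg d f.

Definition regular_OP (R : realType) (n : nat) (K : set 'rV[R]_n)
    (f : mpoly.mpoly n R) : Prop :=
  bounded_set
    (Sol (asymptotic_cone K) (polyfun (homog_component (mpoly_degree f) f))).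

(* Main.v *)
Require Import Defs.
From HB Require Import structures.
From mathcomp Require Import all_boot all_order all_algebra.
From mathcomp Require Import all_classical all_reals all_analysis.
From mathcomp Require mpoly.
(* The canonical structures on exponents, without the clashing notations. *)
Import (canonicals, coercions) mpoly.
Import Order.TTheory GRing.Theory Num.Theory.
Import numFieldNormedType.Exports.

(** Write F for the leading form of f and d for its degree.

    From (b) to (a): let x minimize f on K, and let v be a nonzero recession
    direction of K.  If no point of K has a gradient of positive inner product
    with v, then pseudoconvexity at x + s v, tested against x, gives
    f (x + s v) <= f x, so the whole ray from x along v consists of minimizers
    and Sol(K, f) is unbounded.  See [ascent_of_compact_Sol].

    From (a) to (b): call x in K a truncated minimizer if f x is the least
    value of f at the points of K that are no longer than x.  As soon as the
    truncated minimizers are bounded, Sol(K, f) is nonempty and compact: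
    minimizers are truncated minimizers, and a minimizer of f on a large ball
    is global because on every larger ball the minimum is attained at a
    truncated minimizer ([Sol_nonempty_compact]).

    Suppose then that truncated minimizers x_k go to infinity in the direction
    v.  Since f (x_k) stays bounded above, F v <= 0.  Non-regularity says that
    F has a minimizer on the asymptotic cone, so F is nonnegative there by
    homogeneity ([leading_form_ge0]), and v is one of the directions to which
    (a) applies: some p in K has a gradient of positive inner product with v.
    A short step from p along v leads to a point q of K with f p < f q at which
    the gradient still makes a positive inner product with v ([C1_increase]).
    The directions of x_k - q tend to v, so pseudoconvexity at q gives
    f q <= f (x_k) for large k, whereas f (x_k) <= f p because x_k is a
    truncated minimizer longer than p.  This contradicts f p < f q
    ([truncated_min_bounded]).  The step from p to q is what makes
    pseudoconvexity, which only yields large inequalities, produce the strict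
    one. *)

Local Open Scope classical_set_scope.
Local Open Scope ring_scope.

(** * Continuously differentiable functions *)

Definition C1 {R : realType} {n : nat} (g : 'rV[R]_n -> R) : Prop :=
  (forall x, differentiable g x) /\
  (forall v, continuous (fun x => 'D_v g x)).

Lemma C1_continuous {R : realType} {n : nat} (g : 'rV[R]_n -> R) :
  C1 g -> continuous g.
Proof. by move=> [dg _] x; apply: differentiable_continuous. Qed.

Lemma C1_cst {R : realType} {n : nat} (c : R) : C1 (fun _ : 'rV[R]_n => c).
Proof.
split=> [x|v x]; first exact: differentiable_cst.
have -> : (fun y => 'D_v (fun _ : 'rV[R]_n => c) y) = cst 0.
  by apply/funext => y; exact: (derive_cst (c : R)).
exact: cst_continuous.
Qed.

Lemma C1_coord {R : realType} {n : nat} (i : 'I_n) :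
  C1 (fun x : 'rV[R]_n => x 0 i).
Proof.
split=> [x|v x]; first exact: differentiable_coord.
suff -> : (fun y => 'D_v (fun z : 'rV[R]_n => z 0 i) y) = cst (v 0 i).
  exact: cst_continuous.
apply/funext => y; rewrite /derive.
apply: (@cvg_lim _ (@Rhausdorff R)).
apply: cvg_near_cst; near=> h.
have h0 : h != 0 by near: h; exact: nbhs_dnbhs_neq.
by rewrite /= !mxE addrK /GRing.scale /= mulrA mulVf ?mul1r.
Unshelve. all: by end_near. Qed.

Lemma C1D {R : realType} {n : nat} (g h : 'rV[R]_n -> R) :
  C1 g -> C1 h -> C1 (fun x => g x + h x).
Proof.
move=> Cg Ch; split=> [x|v x]; first exact: differentiableD (Cg.1 x) (Ch.1 x).
suff -> : (fun y => 'D_v (fun z => g z + h z) y) =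
    (fun y => 'D_v g y + 'D_v h y).
  exact: (cvgD (Cg.2 v x) (Ch.2 v x)).
apply/funext => y.
by rewrite -deriveD //; apply: diff_derivable; [apply: Cg.1 | apply: Ch.1].
Qed.

Lemma C1M {R : realType} {n : nat} (g h : 'rV[R]_n -> R) :
  C1 g -> C1 h -> C1 (fun x => g x * h x).
Proof.
move=> Cg Ch; split=> [x|v x]; first exact: differentiableM (Cg.1 x) (Ch.1 x).
suff -> : (fun y => 'D_v (fun z => g z * h z) y) =
    (fun y => g y * 'D_v h y + h y * 'D_v g y).
  have cg := C1_continuous _ Cg x; have ch := C1_continuous _ Ch x.
  exact: (cvgD (cvgM cg (Ch.2 v x)) (cvgM ch (Cg.2 v x))).
apply/funext => y.
rewrite (@deriveM _ _ g h) //; apply: diff_derivable;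
  by [apply: Cg.1 | apply: Ch.1].
Qed.

Lemma C1_sum {R : realType} {n : nat} {I : Type} (r : seq I)
    (g : I -> 'rV[R]_n -> R) :
  (forall i, C1 (g i)) -> C1 (fun x => \sum_(i <- r) g i x).
Proof.
move=> Cg; elim: r => [|i r IHr].
  under eq_fun do rewrite big_nil; exact: C1_cst.
by under eq_fun do rewrite big_cons; exact: C1D.
Qed.

Lemma C1_prod {R : realType} {n : nat} {I : Type} (r : seq I)
    (g : I -> 'rV[R]_n -> R) :
  (forall i, C1 (g i)) -> C1 (fun x => \prod_(i <- r) g i x).
Proof.
move=> Cg; elim: r => [|i r IHr].
  under eq_fun do rewrite big_nil; exact: C1_cst.
by under eq_fun do rewrite big_cons; exact: C1M.
Qed.

Lemma C1X {R : realType} {n : nat} (g : 'rV[R]_n -> R) k :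
  C1 g -> C1 (fun x => g x ^+ k).
Proof.
move=> Cg; elim: k => [|k IHk].
  under eq_fun do rewrite expr0; exact: C1_cst.
by under eq_fun do rewrite exprS; exact: C1M.
Qed.

Lemma C1_polyfun {R : realType} {n : nat} (f : mpoly.mpoly n R) :
  C1 (polyfun f).
Proof.
rewrite /polyfun; under eq_fun do rewrite mpoly.mevalE.
apply: C1_sum => m; apply: C1M; first exact: C1_cst.
by apply: C1_prod => i; apply: C1X; exact: C1_coord.
Qed.

Lemma derive_inner_gradient {R : realType} {n : nat} (g : 'rV[R]_n -> R) x v :
  differentiable g x -> 'D_v g x = inner (gradient g x) v.
Proof.
move=> dg; rewrite deriveE // {1}[v]row_sum_delta linear_sum /=.
by apply: eq_bigr => i _; rewrite linearZ /= mxE deriveE // mulrC.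
Qed.

(** The difference quotients of g at x along v and the derivative along v at
    x + e v both tend to the derivative at x, hence are both positive for one
    small step e. *)
Lemma C1_increase {R : realType} {n : nat} (g : 'rV[R]_n -> R) x v :
  C1 g -> 0 < inner (gradient g x) v ->
  exists e, [/\ 0 < e, g x < g (x + e *: v) &
                0 < inner (gradient g (x + e *: v)) v].
Proof.
move=> [dg cDg]; rewrite -derive_inner_gradient // => Dpos.
have cline : (fun e : R => x + e *: v) @ 0^'+ --> x.
  rewrite -[X in _ --> X]addr0 -(scale0r v).
  apply: cvgD; first exact: cvg_cst.
  apply: cvgZr_tmp.
  by apply: cvg_at_right_filter; exact: cvg_id.
have cD : 'D_v g (x + e *: v) @[e --> 0^'+] --> 'D_v g x.
  exact: (cvg_comp _ _ cline (cDg v x)).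
have quot : (fun h => h^-1 *: ((g \o shift x) (h *: v) - g x)) @ 0^'+
    --> 'D_v g x.
  apply: cvg_dnbhs_at_right; exact: (@diff_derivable _ _ _ _ _ v (dg x)).
have [e [epos e1 e2]] : exists e : R, [/\ 0 < e,
   0 < e^-1 *: ((g \o shift x) (e *: v) - g x) & 0 < 'D_v g (x + e *: v)].
  apply: (@filter_ex _ (0^'+)).
  near=> e; split; near: e.
  - exact: nbhs_right_gt.
  - exact: (cvgr_gt _ quot).
  - exact: (cvgr_gt _ cD).
exists e; split=> //; last by rewrite -derive_inner_gradient.
by move: e1; rewrite /GRing.scale /= pmulr_rgt0 ?invr_gt0 // subr_gt0 addrC.
Unshelve. all: by end_near. Qed.

(** * The leading form as a limit *)

Lemma mdeg_le_degree {R : realType} {n : nat} (f : mpoly.mpoly n R)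
    (m : mpoly.multinom n) :
  m \in mpoly.msupp f -> (mpoly.mdeg m <= mpoly_degree f)%N.
Proof.
move=> /(mpoly.mmeasure_mnm_lt mpoly.mdeg); rewrite /mpoly_degree.
by case: (mpoly.mmeasure _ f).
Qed.

(** Homogeneous of degree d in (s, y) jointly, and polynomial in s: the leading
    form is its value at s = 0, so that the behaviour of f at infinity becomes
    continuity at s = 0. *)
Definition homogenization {R : realType} {n : nat} (f : mpoly.mpoly n R)
    (s : R) (y : 'rV[R]_n) : R :=
  \sum_(m <- mpoly.msupp f)
    mpoly.mcoeff m f * s ^+ (mpoly_degree f - mpoly.mdeg m) *
    \prod_i y 0 i ^+ mpoly.fun_of_multinom m i.

Lemma homogenization0 {R : realType} {n : nat} (f : mpoly.mpoly n R) y :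
  homogenization f 0 y = polyfun (homog_component (mpoly_degree f) f) y.
Proof.
rewrite /polyfun /homog_component mpoly.pihomogE raddf_sum /=.
rewrite [RHS]big_mkcond /=; apply: eq_big_seq => m mf.
case: eqP => [<-|/eqP md].
  by rewrite mpoly.mevalZ mpoly.mevalX subnn expr0 mulr1.
rewrite expr0n subn_eq0 leqNgt ltn_neqAle md mdeg_le_degree //=.
by rewrite mulr0 mul0r.
Qed.

Lemma homogenizationE {R : realType} {n : nat} (f : mpoly.mpoly n R) s y :
  homogenization f s (s *: y) = s ^+ mpoly_degree f * polyfun f y.
Proof.
rewrite /polyfun mpoly.mevalE mulr_sumr; apply: eq_big_seq => m mf.
under eq_bigr do rewrite mxE exprMn.
rewrite big_split /= prodrXr -mpoly.mdegE -mulrA [X in _ * X]mulrA -exprD.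
by rewrite subnK ?mdeg_le_degree // mulrCA.
Qed.

Lemma leading_formZ {R : realType} {n : nat} (f : mpoly.mpoly n R) s y :
  polyfun (homog_component (mpoly_degree f) f) (s *: y) =
  s ^+ mpoly_degree f * polyfun (homog_component (mpoly_degree f) f) y.
Proof.
rewrite /polyfun /homog_component mpoly.pihomogE !raddf_sum /= mulr_sumr.
apply: eq_bigr => m /eqP <-; rewrite !mpoly.mevalZ !mpoly.mevalX.
under eq_bigr do rewrite mxE exprMn.
by rewrite big_split /= prodrXr -mpoly.mdegE mulrCA.
Qed.

Lemma cvg_inv_pinfty {R : realType} (t : nat -> R) :
  t @ \oo --> +oo -> (fun k => (t k)^-1) @ \oo --> 0.
Proof.
move=> toc; apply/gtr0_cvgV0 => //; near=> k; near: k; exact: (cvgry_gt toc).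
Unshelve. all: by end_near. Qed.

(** The scaled value is the homogenization at (1 / t_k, x_k / t_k), which tends
    to (0, v). *)
Lemma asymptotic_leading_term {R : realType} {n : nat} (f : mpoly.mpoly n R)
    (t : nat -> R) (x : nat -> 'rV[R]_n) v :
  t @ \oo --> +oo -> (fun k => (t k)^-1 *: x k) @ \oo --> v ->
  (fun k => (t k)^-1 ^+ mpoly_degree f * polyfun f (x k)) @ \oo -->
    polyfun (homog_component (mpoly_degree f) f) v.
Proof.
move=> toc uv; rewrite -homogenization0.
under eq_fun do rewrite -homogenizationE.
have tV := cvg_inv_pinfty _ toc.
have cX (w : nat -> R) (a : R) e :
    w @ \oo --> a -> (fun k => w k ^+ e) @ \oo --> a ^+ e.
  by move=> wa; exact: (cvg_comp _ _ wa (@exprn_continuous _ e a)).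
apply: cvg_big => [|m _]; first exact: add_continuous.
have c1 := cX _ _ (mpoly_degree f - mpoly.mdeg m)%N tV.
have c2 : (fun k =>
    \prod_i ((t k)^-1 *: x k) 0 i ^+ mpoly.fun_of_multinom m i) @ \oo
    --> \prod_i v 0 i ^+ mpoly.fun_of_multinom m i.
  apply: cvg_big => [|i _]; first exact: mul_continuous.
  apply: cX; exact: (cvg_comp _ _ uv (@coord_continuous _ 1 n 0 i v)).
exact: (cvgM (cvgM (cvg_cst (mpoly.mcoeff m f)) c1) c2).
Qed.

(** * Recession directions *)

Lemma innerZr {R : realType} {n : nat} (u v : 'rV[R]_n) s :
  inner u (s *: v) = s * inner u v.
Proof.
by rewrite /inner mulr_sumr; apply: eq_bigr => i _; rewrite mxE mulrCA.
Qed.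

Lemma inner_continuous {R : realType} {n : nat} (u : 'rV[R]_n) :
  continuous (inner u).
Proof.
apply: continuous_big => [|i _ x]; first exact: add_continuous.
exact: (cvgM (cvg_cst (u 0 i)) (@coord_continuous _ 1 n 0 i x)).
Qed.

Lemma convex_set_segment {R : realType} {n : nat} (K : set 'rV[R]_n) x y l :
  convex_set K -> K x -> K y -> 0 <= l -> l <= 1 -> K (x + l *: (y - x)).
Proof.
move=> Kconv Kx Ky l0 l1.
have := Kconv y x (Itv01 l0 l1); rewrite !inE => /(_ Ky Kx).
congr (K _); rewrite /conv /=.
by rewrite scalerBl scale1r scalerBr addrCA.
Qed.

(** The points x + (s / t_k) (y_k - x) lie on segments between points of K once
    s <= t_k, and tend to x + s v. *)
Lemma recession {R : realType} {n : nat} (K : set 'rV[R]_n) x v s :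
  closed K -> convex_set K -> K x -> asymptotic_cone K v -> 0 <= s ->
  K (x + s *: v).
Proof.
move=> Kcl Kconv Kx [t [y [toc Ky yv]]] s0.
have tV := cvg_inv_pinfty _ toc.
have lim : (fun k => x + (s * (t k)^-1) *: (y k - x)) @ \oo --> x + s *: v.
  under eq_fun do rewrite -scalerA scalerBr.
  rewrite -[v]subr0 -(scale0r x).
  apply: (cvgD (cvg_cst x)); apply: (cvgZl_tmp (k := s)).
  exact: (cvgB yv (cvgZr_tmp (a := x) tV)).
apply: (closed_cvg K Kcl _ _ lim); near=> k.
have tpos : 0 < t k by near: k; exact: (cvgry_gt toc).
have st : s <= t k by near: k; exact: (cvgry_ge toc).
apply: convex_set_segment => //.
  by rewrite mulr_ge0 // invr_ge0 ltW.
by rewrite ler_pdivrMr // mul1r.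
Unshelve. all: by end_near. Qed.

(** Compactness of the unit sphere; as compactness provides a cluster point of
    the normalized sequence, a convergent subsequence is extracted by choice. *)
Lemma unbounded_direction {R : realType} {n : nat} (A : set 'rV[R]_n) :
  (forall M, exists2 x, A x & M <= `|x|) ->
  exists (x : nat -> 'rV[R]_n) (v : 'rV[R]_n), [/\ forall k, A (x k),
    (fun k => `|x k|) @ \oo --> +oo, v != 0 &
    (fun k => `|x k|^-1 *: x k) @ \oo --> v].
Proof.
move=> Aunb.
have /choice[y yP] : forall k : nat, exists x, A x /\ k.+1%:R <= `|x|.
  by move=> k; have [x Ax kx] := Aunb k.+1%:R; exists x.
have ypos k : 0 < `|y k| by apply: lt_le_trans (yP k).2; rewrite ltr0n.
pose u k := `|y k|^-1 *: y k.
have u1 k : `|u k| = 1.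
  by rewrite normrZ normfV normr_id mulVf // gt_eqF.
pose S : set 'rV[R]_n := [set x | `|x| = 1].
have Scl : closed S.
  apply: (@preimage_closed _ _ _ [set 1 : R]) => [x _|]; last exact: closed_eq.
  exact: norm_continuous.
have Sc : compact S.
  apply: bounded_closed_compact Scl.
  exists 1; split; first exact: num_real.
  by move=> M M1 x /= ->; exact: ltW.
have uS : \forall k \near \oo, S (u k) by near=> k; exact: u1.
have [v [Sv vcl]] := Sc (u @ \oo) _ uS.
have /choice[h hP] : forall j : nat,
    exists k, (j <= k)%N /\ `|v - u k| < j.+1%:R^-1.
  move=> j.
  have tail : \forall k \near \oo, (u @` [set k | (j <= k)%N]) (u k).
    by near=> k; exists k => //=; near: k; exact: nbhs_infty_ge.
  have [] := vcl (u @` [set k | (j <= k)%N]) (ball v (j.+1%:R^-1)) tail.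
    by apply: nbhsx_ballx; rewrite invr_gt0.
  move=> _ [[k /= jk <-] uk]; exists k; split => //.
  by move: uk; rewrite -ball_normE.
exists (y \o h), v; split.
- by move=> k; exact: (yP _).1.
- apply/cvgryPge => M; near=> k.
  apply: le_trans (yP (h k)).2.
  apply: (@le_trans _ _ k%:R); last by rewrite ler_nat ltnW // ltnS (hP k).1.
  near: k; exact: nbhs_infty_ger.
- by rewrite -normr_eq0 (Sv : `|v| = 1) oner_eq0.
- apply/cvgrPdist_lt => e e0; near=> k.
  apply: lt_trans (hP k).2 _.
  near: k; exact: near_infty_natSinv_lt (PosNum e0).
Unshelve. all: by end_near. Qed.

(** * Truncated minimizers *)

Definition truncated_min {R : realType} {n : nat} (K : set 'rV[R]_n)
    (g : 'rV[R]_n -> R) : set 'rV[R]_n :=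
  [set x | K x /\ forall y, K y -> `|y| <= `|x| -> g x <= g y].

Lemma Sol_ball_nonempty {R : realType} {n : nat} (K : set 'rV[R]_n)
    (g : 'rV[R]_n -> R) r y :
  closed K -> continuous g -> K y -> `|y| <= r ->
  exists x, Sol (K `&` [set z | `|z| <= r]) g x.
Proof.
move=> Kcl gc Ky yr.
have [|||x /set_mem Kx xmin] := @EVT_min_rV R n g (K `&` [set z | `|z| <= r]).
- by exists y.
- apply: bounded_closed_compact.
    exists r; split; first exact: num_real.
    by move=> M rM z /= [_ zr]; apply: le_trans zr (ltW rM).
  apply: closedI => //.
  apply: (@preimage_closed _ _ _ [set z : R | z <= r]) => [z _|].
    exact: norm_continuous.
  exact: closed_le.
- exact: continuous_subspaceT.
by exists x; split => // z Kz; apply: xmin; exact: mem_set.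
Qed.

(** With r at least M, a minimizer on the ball of radius r is global: its value
    is at most that of z, a minimizer on the ball of radius `|y|, for z is a
    truncated minimizer and so lies in the ball of radius r. *)
Lemma Sol_nonempty_compact {R : realType} {n : nat} (K : set 'rV[R]_n)
    (g : 'rV[R]_n -> R) M :
  K !=set0 -> closed K -> continuous g ->
  (forall x, truncated_min K g x -> `|x| <= M) ->
  Sol K g !=set0 /\ compact (Sol K g).
Proof.
move=> [x0 Kx0] Kcl gc TM; split.
  (* The radius must also reach x0, for the truncated set to be nonempty. *)
  pose r := Num.max M `|x0|.
  have x0r : `|x0| <= r by rewrite le_max lexx orbT.
  have [x [[Kx xr] xmin]] := Sol_ball_nonempty K g r x0 Kcl gc Kx0 x0r.
  exists x; split=> // y Ky.
  have [z [[Kz zy] zmin]] := Sol_ball_nonempty K g `|y| y Kcl gc Ky (lexx _).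
  have zM : `|z| <= M.
    apply: TM; split=> // w Kw wz.
    by apply: zmin; split=> //=; exact: le_trans zy.
  apply: (@le_trans _ _ (g z)).
    by apply: xmin; split=> //=; rewrite le_max zM.
  by apply: zmin; split=> /=.
apply: bounded_closed_compact.
  exists M; split; first exact: num_real.
  move=> B MB x [Kx xmin]; apply: le_trans (ltW MB); apply: TM.
  by split=> // y Ky _; exact: xmin.
have -> : Sol K g = K `&` \bigcap_(y in K) [set x | g x <= g y].
  apply/seteqP; split=> x [Kx xmin]; split=> //.
apply: closedI => //; apply: closed_bigI => y _.
apply: (@preimage_closed _ _ g [set z : R | z <= g y]) => [z _|].
  exact: gc.
exact: closed_le.
Qed.

(** Unbounded truncated minimizers x_k would have a limit direction v; the two
    sandwiching points p and q = p + e v give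
    f p < f q <= f (x_k) <= f p for large k. *)
Lemma truncated_min_bounded {R : realType} {n : nat} (K U : set 'rV[R]_n)
    (f : mpoly.mpoly n R) :
  closed K -> convex_set K -> K `<=` U -> pseudoconvex_on U (polyfun f) ->
  (0 < mpoly_degree f)%N ->
  (forall v, asymptotic_cone K v -> v != 0 ->
     polyfun (homog_component (mpoly_degree f) f) v <= 0 ->
     exists x, K x /\ 0 < inner (gradient (polyfun f) x) v) ->
  exists M, forall x, truncated_min K (polyfun f) x -> `|x| <= M.
Proof.
move=> Kcl Kconv KU fpc d0 ascent; apply: contrapT => noM.
have [M|x [v [Tx xoo v0 xv]]] :=
  unbounded_direction (truncated_min K (polyfun f)).
  apply: contrapT => TM; apply: noM; exists M => x Tx.
  by rewrite leNgt; apply/negP => Mx; apply: TM; exists x => //; exact: ltW.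
have Kv : asymptotic_cone K v.
  by exists (fun k => `|x k|), x; split => // k; exact: (Tx k).1.
have xV := cvg_inv_pinfty _ xoo.
have fv : polyfun (homog_component (mpoly_degree f) f) v <= 0.
  (* The values f (x_k) are bounded above by f (x_0). *)
  have lim0 : (fun k => `|x k|^-1 ^+ mpoly_degree f * polyfun f (x 0%N))
      @ \oo --> 0.
    have e0 : 0 ^+ mpoly_degree f = 0 :> R by rewrite expr0n gtn_eqF.
    rewrite -(mul0r (polyfun f (x 0%N))) -e0.
    apply: cvgM; last exact: cvg_cst.
    exact: (cvg_comp _ _ xV (@exprn_continuous _ (mpoly_degree f) 0)).
  apply: (ler_cvg_to (asymptotic_leading_term f _ _ v xoo xv) lim0).
  near=> k => /=; apply: ler_wpM2l; first by rewrite exprn_ge0 // invr_ge0.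
  apply: (Tx k).2; first exact: (Tx 0%N).1.
  by near: k; exact: (cvgry_ge xoo).
have [p [Kp pv]] := ascent v Kv v0 fv.
have [e [e0 pq qv]] := C1_increase _ p v (C1_polyfun f) pv.
pose q := p + e *: v.
have Kq : K q by apply: recession => //; exact: ltW.
have dir : (fun k => `|x k|^-1 *: (x k - q)) @ \oo --> v.
  under eq_fun do rewrite scalerBr.
  rewrite -[v]subr0 -(scale0r q).
  exact: (cvgB xv (cvgZr_tmp (a := q) xV)).
have up := cvg_comp _ _ dir (inner_continuous (gradient (polyfun f) q) v).
near \oo => k.
have : polyfun f q <= polyfun f (x k).
  apply: fpc; [exact: KU|apply: KU; exact: (Tx k).1|].
  have xk : 0 < `|x k| by near: k; exact: (cvgry_gt xoo).
  have : 0 < inner (gradient (polyfun f) q) (`|x k|^-1 *: (x k - q)).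
    by near: k; exact: (cvgr_gt _ up).
  by rewrite innerZr pmulr_rgt0 ?invr_gt0 // => /ltW.
apply/negP; rewrite -ltNge; apply: le_lt_trans pq.
apply: (Tx k).2 => //; near: k; exact: (cvgry_ge xoo).
Unshelve. all: by end_near. Qed.

(** On a cone, a form of positive degree that takes a negative value is
    unbounded below. *)
Lemma leading_form_ge0 {R : realType} {n : nat} (K : set 'rV[R]_n)
    (f : mpoly.mpoly n R) :
  (0 < mpoly_degree f)%N ->
  Sol (asymptotic_cone K) (polyfun (homog_component (mpoly_degree f) f))
    !=set0 ->
  forall v, asymptotic_cone K v ->
    0 <= polyfun (homog_component (mpoly_degree f) f) v.
Proof.
move=> d0 [w [_ wmin]] v Kv.
set F := polyfun _ in wmin *.
rewrite leNgt; apply/negP => Fv.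
have Kv' s : 0 < s -> asymptotic_cone K (s *: v).
  move=> s0; case: Kv => t [x [toc Kx xv]].
  exists (fun k => s^-1 * t k), x; split => //.
    apply/cvgryPge => A; near=> k.
    rewrite ler_pdivlMl //; near: k; exact: (cvgry_ge toc).
  under eq_fun do rewrite invfM invrK -scalerA.
  exact: (cvgZl_tmp (k := s) xv).
(* Chosen so that s >= 1, whence s ^+ d * F v <= s * F v, and s * F v < F w. *)
pose s := 1 + `|F w| / - F v.
have s1 : 1 <= s by rewrite lerDl divr_ge0 // oppr_ge0 ltW.
have /= := wmin (s *: v) (Kv' s (lt_le_trans ltr01 s1)).
rewrite /F leading_formZ -/F; apply/negP; rewrite -ltNge.
apply: (@le_lt_trans _ _ (s * F v)).
  by rewrite ler_nM2r // -[leLHS]expr1 ler_weXn2l.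
rewrite /s mulrDl mul1r invrN mulrN mulNr divfK ?lt_eqF //.
apply: (@lt_le_trans _ _ (- `|F w|)); first by rewrite gtrDr.
by rewrite lerNl ler_normr lexx orbT.
Unshelve. all: by end_near. Qed.

(** * The equivalence *)

(** Without ascent along v anywhere in K, the ray from a minimizer along v would
    consist of minimizers. *)
Lemma ascent_of_compact_Sol {R : realType} {n : nat} (K U : set 'rV[R]_n)
    (g : 'rV[R]_n -> R) v :
  closed K -> convex_set K -> K `<=` U -> pseudoconvex_on U g ->
  Sol K g !=set0 -> compact (Sol K g) ->
  asymptotic_cone K v -> v != 0 ->
  exists x, K x /\ 0 < inner (gradient g x) v.
Proof.
move=> Kcl Kconv KU gpc [x [Kx xmin]] Sc Kv v0.
apply: contrapT => noascent.
have ray s : 0 <= s -> Sol K g (x + s *: v).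
  move=> s0; have Kxs : K (x + s *: v) by exact: recession.
  split=> // y Ky; apply: le_trans (xmin y Ky).
  apply: gpc; [exact: KU|exact: KU|].
  rewrite opprD addNKr -scaleNr innerZr mulNr oppr_ge0.
  apply: mulr_ge0_le0 => //; rewrite leNgt; apply/negP => asc.
  by apply: noascent; exists (x + s *: v).
have [M [_ MP]] := compact_bounded Sc.
pose B := Num.max (M + 1) 0.
have MB : M < B by rewrite lt_max ltrDl ltr01.
(* Far enough along the ray to leave the ball of radius B. *)
pose s := (B + `|x| + 1) / `|v|.
have vpos : 0 < `|v| by rewrite normr_gt0.
have B0 : 0 <= B by rewrite le_max lexx orbT.
have s0 : 0 <= s by rewrite divr_ge0 // !addr_ge0.
have /= := MP B MB _ (ray s s0).
apply/negP; rewrite -ltNge.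
have : `|s *: v| <= `|x + s *: v| + `|x|.
  by rewrite -{1}(addKr x (s *: v)) addrC; apply: ler_normB.
rewrite normrZ ger0_norm // divfK ?gt_eqF // -addrA addrCA.
rewrite [X in _ <= X]addrC lerD2l.
by apply: lt_le_trans; rewrite ltrDl.
Qed.

Theorem theorem3p2 (R : realType) (n : nat) (K U : set 'rV[R]_n)
    (f : mpoly.mpoly n R) (d : nat)
    (K_nonempty : K !=set0) (K_closed : closed K) (K_convex : convex_set K)
    (f_degree : mpoly_degree f = d) (d_ge2 : (2 <= d)%N)
    (U_open : open U) (K_sub_U : K `<=` U)
    (f_pseudoconvex : pseudoconvex_on U (polyfun f))
    (nonregular : ~ regular_OP K f) :
  (forall v : 'rV[R]_n,
      (Sol (asymptotic_cone K) (polyfun (homog_component d f)) `\ 0) v ->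
      exists x : 'rV[R]_n, K x /\ 0 < inner (gradient (polyfun f) x) v)
  <->
  (Sol K (polyfun f) !=set0 /\ compact (Sol K (polyfun f))).
Proof.
subst d; have d_gt0 : (0 < mpoly_degree f)%N by exact: ltnW.
split=> [ascent|[Sol0 Solc] v [[Kv _] v0]]; last first.
  by apply: (ascent_of_compact_Sol K U) => //; exact/eqP.
have Sol_inf_nonempty : Sol (asymptotic_cone K)
    (polyfun (homog_component (mpoly_degree f) f)) !=set0.
  apply/set0P/eqP => Sol_inf0; apply: nonregular.
  rewrite /regular_OP Sol_inf0.
  by exists 0; split; [exact: num_real|move=> M _ x []].
have [|M TM] := truncated_min_bounded K U f K_closed K_convex K_sub_U
  f_pseudoconvex d_gt0 _.
  move=> v Kv v0 fv; apply: ascent; split; last exact/eqP.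
  split=> // w Kw; apply: (le_trans fv); exact: leading_form_ge0 Kw.
apply: Sol_nonempty_compact TM => //.
exact/C1_continuous/C1_polyfun.
Qed.
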